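(* Let $\mathcal A':f'=0$ be a line arrangement in $\mathbb P^2$ with $d'\ge 2$ lines and let $L$ be a generic line. Consider the new line arrangement $\mathcal A=\mathcal A'\cup L$, and put $r'=r(\mathcal A')$, $r=r(\mathcal A)$. Then: (1) The weak combinatorics of $\mathcal A'$ determines the weak combinatorics of $\mathcal A$, and the combinatorics of $\mathcal A'$ determines the combinatorics of $\mathcal A$. In particular, $\tau(\mathcal A)=\tau(\mathcal A')+d'$. (2) $r=r'+1$.
   Context: $\mathbb K$ is a field of characteristic zero, $S=\mathbb K[x,y,z]$ with the standard grading. A line arrangement $\mathcal A$ in $\mathbb P^2$ is a finite set of distinct lines, given by $f=0$ with $f\in S$ a product of pairwise non-proportional linear forms. $r(\mathcal A)$ is the minimal degree $r$ for which there is a nonzero triple $(a,b,c)\in S_r^3$ with $af_x+bf_y+cf_z=0$. The multiplicity of a point is the number of lines of the arrangement through it; $n_j$ denotes the number of points of multiplicity $j\ge 2$. The combinatorics of $\mathcal A$ is its intersection lattice $L(\mathcal A)$, the weak combinatorics is the collection of numbers $n_j$, $j\ge2$, and the global Tjurina number is $\tau(\mathcal A)=\sum_{j\ge 2}n_j(j-1)^2$. A generic line means a line $L\notin\mathcal A'$ meeting $\mathcal A'$ only at simple points, i.e. containing no point of multiplicity $\ge 2$ of $\mathcal A'$. *)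

(* Defs.v *)
From mathcomp Require Import all_boot all_order all_algebra.
From mathcomp Require Import boolp.
From mathcomp Require Import mpoly.

Set Implicit Arguments.
Unset Strict Implicit.
Unset Printing Implicit Defensive.

Import GRing.Theory.
Local Open Scope ring_scope.

(* A linear form l_0 x + l_1 y + l_2 z on K^3 is encoded by its coefficient
   vector l : 'rV[K]_3.  Linear subspaces of P^2 are represented by their cones
   in K^3: a point of P^2 is a subspace P with \dim P = 1, and a line is a
   subspace of dimension 2.  A line arrangement is a sequence of nonzero,
   pairwise non-proportional linear forms. *)

Section Arrangements.
Variable K : fieldType.
Implicit Types (l m L : 'rV[K]_3) (A B : seq 'rV[K]_3).
Implicit Types (P X Y : {vspace 'rV[K]_3}).

Definition linear_form l : {mpoly K[3]} := \sum_(i < 3) l 0 i *: 'X_i.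

Definition line l : {vspace 'rV[K]_3} :=
  lker (linfun (fun v : 'rV[K]_3 => v *m l^T)).

Lemma mem_line l (v : 'rV[K]_3) :
  (v \in line l) = ((linear_form l).@[fun i => v 0 i] == 0).
Proof.
rewrite memv_ker (lfunE (mulmxr l^T)) /= /linear_form.
rewrite raddf_sum /=.
rewrite (eq_bigr (fun i => v 0 i * l^T i 0)); last first.
  by move=> i _; rewrite mevalZ mevalXU mxE mulrC.
apply/eqP/eqP => [/matrixP/(_ 0 0)|h]; first by rewrite !mxE.
by apply/matrixP => i j; rewrite !ord1 !mxE.
Qed.

Definition is_arrangement A : bool :=
  all (fun l => l != 0) A && pairwise (fun l m => m \notin <[l]>%VS) A.

Definition defining_poly A : {mpoly K[3]} := \prod_(l <- A) linear_form l.

Definition mult A P : nat := count (fun l => (P <= line l)%VS) A.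

(* Over two proportional (in particular equal) forms the intersection has
   dimension 2, so only intersections of distinct lines are retained. *)
Definition multiple_points A : seq {vspace 'rV[K]_3} :=
  undup [seq P <- [seq (line l :&: line m)%VS | l <- A, m <- A] | \dim P == 1%N].

(* The number n_j of points of multiplicity j; only meaningful for j >= 2. *)
Definition n_points A j : nat :=
  count (fun P => mult A P == j) (multiple_points A).

Definition same_weak_combinatorics A B : Prop :=
  forall j, (2 <= j)%N -> n_points A j = n_points B j.

(* The multiplicity of a point is at most size A, so no term is missed. *)
Definition global_tjurina A : nat :=
  (\sum_(2 <= j < (size A).+1) n_points A j * (j - 1) ^ 2)%N.

(* Elements of the intersection lattice L(A): the intersections of subfamilies
   of A, with the whole space as the empty intersection. *)
Definition is_flat A X : Prop :=
  exists2 B, {subset B <= A} & X = (\bigcap_(l <- B) line l)%VS.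

(* L(A) and L(B) are isomorphic as posets (hence as lattices); injectivity of
   phi on the flats follows from the last clause. *)
Definition same_combinatorics A B : Prop :=
  exists phi : {vspace 'rV[K]_3} -> {vspace 'rV[K]_3},
    [/\ forall X, is_flat A X -> is_flat B (phi X),
        forall Y, is_flat B Y -> exists2 X, is_flat A X & phi X = Y
      & forall X Y, is_flat A X -> is_flat A Y ->
          (phi X <= phi Y)%VS = (X <= Y)%VS].

Definition is_generic_line A L : Prop :=
  [/\ L != 0, all (fun l => L \notin <[l]>%VS) A
    & forall P, \dim P = 1%N -> (P <= line L)%VS -> (mult A P <= 1)%N].

Definition has_jacobian_syzygy (f : {mpoly K[3]}) (r : nat) : Prop :=
  exists a : 'I_3 -> {mpoly K[3]},
    [/\ forall i, a i \is r.-homog, exists i, a i != 0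
      & \sum_(i < 3) a i * f^`M(i) = 0].

Lemma mderiv_homog (f : {mpoly K[3]}) d i :
  f \is d.-homog -> f^`M(i) \is d.-1.-homog.
Proof.
move=> /dhomogP hf; apply/dhomogP => m; rewrite mcoeff_msupp mcoeff_mderiv => h.
have /hf <- : (m + U_(i))%MM \in msupp f.
  by rewrite mcoeff_msupp; apply: contraNneq h => ->; rewrite mul0rn.
by rewrite /= mdegD mdeg1 addn1.
Qed.

Lemma linear_form_homog l : linear_form l \is 1.-homog.
Proof.
by apply: rpred_sum => i _; apply: dhomogZ; rewrite dhomogX /= mdeg1.
Qed.

Lemma defining_poly_homog A : defining_poly A \is (size A).-homog.
Proof.
elim: A => [|l A IH]; first by rewrite /defining_poly big_nil dhomog1.
rewrite /defining_poly big_cons.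
exact: (dhomogM (linear_form_homog l) IH).
Qed.

Lemma jacobian_syzygy_exists A :
  exists r, `[< has_jacobian_syzygy (defining_poly A) r >].
Proof.
set f := defining_poly A; have hf := defining_poly_homog A.
pose i1 : 'I_3 := lift ord0 ord0.
have [f0|f0] := eqVneq (f^`M(ord0)) 0.
  exists 0%N; apply/asboolP; exists (fun i => (i == ord0)%:R); split.
  - by move=> i; case: eqP; rewrite ?dhomog1 ?dhomog0.
  - by exists ord0; exact: oner_neq0.
  - by rewrite big_ord_recl /= f0 mulr0 add0r big1 // => i _; rewrite mul0r.
exists (size A).-1; apply/asboolP.
exists (fun i => if i == ord0 then f^`M(i1)
                 else if i == i1 then - f^`M(ord0) else 0); split.
- move=> i; case: ifP => _; first exact: mderiv_homog.
  by case: ifP => _; rewrite ?dhomog0 // rpredN mderiv_homog.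
- by exists i1; rewrite /= oppr_eq0.
- rewrite !big_ord_recl big_ord0 /= mul0r !addr0 mulNr.
  by rewrite [X in _ - X]mulrC subrr.
Qed.

(* r(A), the minimal degree of a nonzero Jacobian syzygy. *)
Definition mdr A : nat := ex_minn (jacobian_syzygy_exists A).

Lemma dim_line_ge l : (2 <= \dim (line l))%N.
Proof.
rewrite -(leq_add2r 1) /line.
have := limg_ker_dim (linfun (fun v : 'rV[K]_3 => v *m l^T)) fullv.
rewrite capfv dimvf dim_matrix mul1r => h.
rewrite addn1 -[X in (X <= _)%N]h leq_add2l.
by apply: leq_trans (dimvS (subvf _)) _; rewrite dimvf dim_matrix.
Qed.

Lemma dim_capv_line l m : l != 0 -> m \notin <[l]>%VS ->
  \dim (line l :&: line m)%VS = 1%N.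
Proof.
move=> l0 lm; pose M := (col_mx l m)^T.
have rkM : \rank M = 2.
  apply/eqP; rewrite eqn_leq rank_leq_col mxrank_tr -addsmxE.
  have := l0; rewrite -mxrank_eq0 -lt0n => h; apply: leq_ltn_trans h _.
  apply: rank_ltmx; rewrite /ltmx addsmxSl addsmx_sub submx_refl /=.
  by apply: contra lm => /sub_rVP[a ->]; rewrite memvZ ?memv_line.
have /row_fullP[B BM] : row_full M by rewrite /row_full rkM.
pose g := linfun (mulmxr M : 'rV[K]_3 -> 'rV[K]_(1 + 1)).
have -> : (line l :&: line m)%VS = lker g.
  apply/vspaceP => v; rewrite memv_cap !memv_ker.
  rewrite (lfunE (mulmxr l^T)) (lfunE (mulmxr m^T)) (lfunE (mulmxr M)) /=.
  by rewrite /M tr_col_mx mul_mx_row row_mx_eq0.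
have := limg_ker_dim g fullv; rewrite capfv.
have -> : limg g = fullv.
  apply/vspaceP => w; rewrite memvf; apply/memv_imgP.
  exists (w *m B); first exact: memvf.
  by rewrite (lfunE (mulmxr M)) /= -mulmxA BM mulmx1.
by rewrite !dimvf !dim_matrix !mul1r => /eqP; rewrite (eqn_add2r 2 _ 1) => /eqP.
Qed.

Lemma mem_multiple_points A P : is_arrangement A ->
  (P \in multiple_points A) = (\dim P == 1%N) && (2 <= mult A P)%N.
Proof.
case/andP=> /allP A0 pwA; rewrite mem_undup mem_filter.
case: eqP => //= dP; apply/allpairsP/idP => [[[l m] /= [lA mA eP]]|].
  have lm : l != m.
    apply/eqP => lm; have := dim_line_ge l.
    by rewrite -[line l]capvv {2}lm -eP dP.
  rewrite /mult -size_filter.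
  apply: (@uniq_leq_size _ [:: l; m]); first by rewrite /= inE lm.
  move=> k; rewrite !inE mem_filter eP => /orP[]/eqP ->.
    by rewrite capvSl.
  by rewrite capvSr.
rewrite /mult -size_filter.
have := filter_subseq (fun l => (P <= line l)%VS) A.
have := mem_filter (fun l => (P <= line l)%VS) ^~ A.
case: (filter _ A) => [//|l [//|m s]] hin hsub _.
have /andP[Pl lA] : (P <= line l)%VS && (l \in A) by rewrite -hin !inE eqxx.
have /andP[Pm mA] : (P <= line m)%VS && (m \in A).
  by rewrite -hin !inE eqxx orbT.
exists (l, m); split=> //=; apply/eqP.
rewrite eqEdim subv_cap Pl Pm dP dim_capv_line ?A0 //.
by have /= /andP[/andP[]] := subseq_pairwise hsub pwA.
Qed.

End Arrangements.

(* Main.v *)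
From HB Require Import structures.
Require Import Defs.
From mathcomp Require Import all_boot all_order all_algebra.
From mathcomp Require Import boolp mpoly.
From mathcomp Require Import ring zify.
Import GRing.Theory.
Local Open Scope ring_scope.

Set Implicit Arguments.
Unset Strict Implicit.
Unset Printing Implicit Defensive.

(** Write f' and f = L f' for the defining polynomials, d' for the number of
lines of A', and E for the Euler field x d/dx + y d/dy + z d/dz.

Combinatorics.  A generic line L meets the lines of A' in d' distinct points,
each lying on a single line of A'.  Hence the multiple points of A are those of
A', with unchanged multiplicities, together with d' double points
([n_points_generic]); the formula for the Tjurina number is then a summation.
The number d' itself is determined by the n_j through
d' (d' - 1) = sum_j n_j j (j - 1), which counts the ordered pairs of distinct
lines by their intersection point ([size_weak_combinatorics]).  For the lattice,
the flats of A are the flats X of A' and their traces X cap L, and genericity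
makes the inclusions between them depend only on the inclusions between flats
of A' and on their dimensions ([trace_le]).  An isomorphism of lattices
preserves dimensions ([flat_isomorphism_dim]), so it extends to the traces.

Minimal degree of a syzygy.  A triple (a, b, c) is regarded as the vector field
D = a d/dx + b d/dy + c d/dz.  If D multiplies a form g of degree n by q, then
n D - q E annihilates g: this Euler correction turns fields tangent to an
arrangement into syzygies.

- r <= r' + 1: if D annihilates f', then L D multiplies f by D(L).

- r' <= d' - 2: if two lines l, m of A' meet at v and f' = l m h, then the
  constant field v annihilates l and m, so h v multiplies f' by v(h).

- r' + 1 <= r: by the previous bound, r + 1 < d' may be assumed.  Let D of
  degree r annihilate f.  It is tangent to L and to each line of A', so at the
  d' points of L on lines of A' it points in the radial direction.  The
  determinant comparing D and E on L is a form of degree r + 1 < d' with d'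
  zeros, so it vanishes, and D is a multiple q E of the Euler field on L
  ([restricted_field_radial]).  Correct D into a field D' annihilating f'; on L
  this is again a multiple of E, and as E f' = d' f' is nonzero on L, D'
  vanishes on L.  Thus D' = L T, and T is a syzygy of f' of degree r - 1
  ([syzygy_divided_by_generic_line]).

All statements on L are made algebraic by an endomorphism of K[x, y, z] with
kernel (L), namely composition with a linear projection of K^3 onto the plane
L = 0 ([restrict]). *)

(** * Vector fields and divisibility by linear forms *)

Section Algebra.
Variable K : fieldType.
Implicit Types (l m k L c : 'rV[K]_3) (A : seq 'rV[K]_3).
Implicit Types (p q h : {mpoly K[3]}) (a b : 'I_3 -> {mpoly K[3]}).

Definition divides p h := exists q, h = p * q.

Definition derive a p : {mpoly K[3]} := \sum_(i < 3) a i * p^`M(i).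

Lemma deriveM a p q : derive a (p * q) = derive a p * q + p * derive a q.
Proof.
rewrite /derive mulr_suml mulr_sumr -big_split /=.
by apply: eq_bigr => i _; rewrite mderivM; ring.
Qed.

Lemma derive_comb p q a b h :
  derive (fun i => p * a i + q * b i) h = p * derive a h + q * derive b h.
Proof.
rewrite /derive !mulr_sumr -big_split /=.
by apply: eq_bigr => i _; ring.
Qed.

Lemma derive_linear_form a l : derive a (linear_form l) = \sum_i l 0 i *: a i.
Proof.
apply: eq_bigr => i _; rewrite /linear_form raddf_sum (bigD1 i) //=.
rewrite big1 => [|j ji]; rewrite mderivZ mderivX mnm1E.
  by rewrite eqxx -{1}[U_(i)%MM]add0m addmK mpolyX0 scale1r addr0 -scalerAr mulr1.
by rewrite (negbTE ji) scale0r scaler0.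
Qed.

Lemma euler A :
  derive (fun i => 'X_i) (defining_poly A) = (size A)%:R * defining_poly A.
Proof.
elim: A => [|l A IH].
  rewrite /defining_poly big_nil mul0r /derive big1 // => i _.
  by rewrite -mpolyC1 mderivC mulr0.
rewrite /defining_poly big_cons deriveM -/(defining_poly A) IH.
by rewrite derive_linear_form -/(linear_form l) /= -[(size A).+1]addn1 natrD; ring.
Qed.

Lemma linear_form_is_linear : linear (@linear_form K).
Proof.
move=> x l m; rewrite /linear_form scaler_sumr -big_split /=.
by apply: eq_bigr => i _; rewrite !mxE scalerDl scalerA.
Qed.
HB.instance Definition _ :=
  GRing.isLinear.Build K 'rV[K]_3 {mpoly K[3]} _ (@linear_form K)
    linear_form_is_linear.

Lemma linear_form_eq0 l : (linear_form l == 0) = (l == 0).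
Proof.
apply/eqP/eqP => [l0|->]; last exact: linear0.
apply/rowP => i; have := congr1 (mcoeff U_(i)) l0.
rewrite mxE mcoeff0 /linear_form raddf_sum (bigD1 i) //= big1 => [|j ji].
  by rewrite mcoeffZ mcoeffX eqxx mulr1 addr0.
by rewrite mcoeffZ mcoeffX eq_mnm1 (negbTE ji) mulr0.
Qed.

(** When [pairing l c = 1], the map v |-> v - l(v) c is the projection of K^3
onto the plane l = 0 along c, and [restrict l c] is composition with it: it
represents restriction to the line l by an endomorphism of K[x, y, z]. *)
Definition restrict l c p : {mpoly K[3]} :=
  p \mPo [tuple 'X_i - c 0 i *: linear_form l | i < 3].

HB.instance Definition _ l c := GRing.RMorphism.copy (restrict l c)
  (comp_mpoly [tuple 'X_i - c 0 i *: linear_form l | i < 3]).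
HB.instance Definition _ l c := GRing.Linear.copy (restrict l c)
  (comp_mpoly [tuple 'X_i - c 0 i *: linear_form l | i < 3]).

Definition pairing l c := \sum_i l 0 i * c 0 i.

Lemma restrictX l c i : restrict l c 'X_i = 'X_i - c 0 i *: linear_form l.
Proof. by rewrite /restrict comp_mpolyXU -tnth_nth tnth_mktuple. Qed.

Lemma restrict_linear_form l c m :
  restrict l c (linear_form m) = linear_form (m - pairing m c *: l).
Proof.
rewrite raddfB /= linearZ /= {1 2}/linear_form raddf_sum scaler_suml -sumrB.
by apply: eq_bigr => i _; rewrite /= linearZ /= restrictX scalerBr scalerA.
Qed.

Lemma restrict_self l c : pairing l c = 1 -> restrict l c (linear_form l) = 0.
Proof.
by move=> lc; rewrite restrict_linear_form lc scale1r subrr linear0.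
Qed.

Lemma variable_homog i : ('X_i : {mpoly K[3]}) \is 1.-homog.
Proof. by rewrite dhomogX /= mdeg1. Qed.

Lemma dhomog_prodX d (n : nat) (e : 'I_n -> nat) (u : 'I_n -> {mpoly K[3]}) :
  (forall i, u i \is d.-homog) ->
  \prod_(i < n) u i ^+ e i \is (\sum_(i < n) d * e i).-homog.
Proof.
move=> hu; apply: (big_ind2 (fun p s => p \is s.-homog)) => [|p x q y|i _].
- exact: dhomog1.
- exact: dhomogM.
- exact: dhomogMn.
Qed.

Lemma restrict_homog l c d p : p \is d.-homog -> restrict l c p \is d.-homog.
Proof.
move=> /dhomogP hp; rewrite /restrict comp_mpolyEX big_seq rpred_sum // => m mp.
apply: dhomogZ; rewrite comp_mpolyX -(hp m mp) /= mdegE.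
rewrite -(eq_bigr _ (fun i _ => mul1n (m i))).
apply: dhomog_prodX => i; rewrite tnth_mktuple rpredB ?dhomogX /= ?mdeg1 //.
by apply: dhomogZ; exact: linear_form_homog.
Qed.

(** Multiplication by a homogeneous p of degree e carries the component of degree
k of q to that of degree k + e of the product, and is injective. *)
Lemma homog_factor (n : nat) (R : idomainType) (p q : {mpoly R[n]}) d e :
  p != 0 -> p \is e.-homog -> p * q \is d.-homog ->
  q \is (d - e).-homog /\ ((d < e)%N -> q = 0).
Proof.
move=> p0 hp hpq.
have [N] : {N | mmeasure mdeg q <= N}%N by exists (mmeasure mdeg q).
move=> /pihomog_partitionE qE.
have q0 (k : 'I_N) : (k + e)%N != d -> pihomog mdeg k q = 0.
  move=> ked; apply/eqP; rewrite -(inj_eq (mulfI p0)) mulr0; apply/eqP.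
  rewrite eq_sym in ked; rewrite -(pihomog_ne0 ked hpq).
  rewrite [in RHS]qE [in RHS]mulr_sumr.
  rewrite [RHS]linear_sum [RHS](bigD1 k) //= [in RHS]big1 => [|j jk].
    rewrite addr0 [RHS]pihomog_dE // addnC.
    exact: dhomogM hp (pihomogP _ _ _).
  apply: (@pihomog_ne0 _ _ _ (e + j)%N); last exact: dhomogM hp (pihomogP _ _ _).
  by rewrite addnC eqn_add2r; exact: jk.
split=> [|de]; rewrite qE.
  apply: rpred_sum => k _; have [kd|/q0 ->] := eqVneq (k + e)%N d.
    by rewrite -kd addnK pihomogP.
  exact: dhomog0.
rewrite big1 // => k _; apply: q0; apply: contraTneq de => <-.
by rewrite -leqNgt leq_addl.
Qed.

(** The class of polynomials congruent to their restriction modulo l is a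
subalgebra, and it contains the variables. *)
Lemma sub_restrict l c p : divides (linear_form l) (p - restrict l c p).
Proof.
pose P p := divides (linear_form l) (p - restrict l c p).
have PC x : P x%:MP by exists 0; rewrite /restrict comp_mpolyC subrr mulr0.
have PX i : P 'X_i.
  by exists (c 0 i)%:MP; rewrite restrictX mulrC mul_mpolyC; ring.
have PD q h : P q -> P h -> P (q + h).
  move=> [s qs] [t ht]; exists (s + t); rewrite rmorphD /=.
  by rewrite mulrDr -qs -ht; ring.
have PM q h : P q -> P h -> P (q * h).
  move=> [s qs] [t ht]; exists (s * h + restrict l c q * t).
  rewrite mulrDr mulrA -qs mulrCA -ht rmorphM /=; ring.
rewrite -/(P p) (mpolyE p); apply: (big_ind P) => [||m _] //.
  by rewrite -mpolyC0; exact: PC.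
rewrite -mul_mpolyC; apply: (PM) => //.
rewrite mpolyXE_id; apply: (big_ind P) => [|p1 p2|i _].
- by rewrite -mpolyC1; exact: PC.
- exact: PM.
elim: (fun_of_multinom m i) => [|n IH]; first by rewrite expr0 -mpolyC1; exact: PC.
by rewrite exprS; exact: PM.
Qed.

Lemma mem_line_pairing l v : (v \in line l) = (pairing l v == 0).
Proof.
rewrite mem_line /linear_form raddf_sum /=; congr (_ == _).
by apply: eq_bigr => i _; rewrite mevalZ mevalXU.
Qed.

Lemma pairing_comb x l y m v :
  pairing (x *: l + y *: m) v = x * pairing l v + y * pairing m v.
Proof.
rewrite /pairing !mulr_sumr -big_split; apply: eq_bigr => i _ /=.
by rewrite !mxE; ring.
Qed.

Lemma pairing_exists l : l != 0 -> exists c, pairing l c = 1.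
Proof.
case/rV0Pn => i li; exists ((l 0 i)^-1 *: delta_mx 0 i).
rewrite /pairing (bigD1 i) //= big1 => [|j ji]; rewrite !mxE eqxx /=.
  by rewrite eqxx mulr1 mulfV ?addr0.
by rewrite (negbTE ji) !mulr0.
Qed.

Lemma divides_restrict l c p : pairing l c = 1 ->
  divides (linear_form l) p <-> restrict l c p = 0.
Proof.
move=> lc; split=> [[q ->]|p0]; first by rewrite rmorphM /= restrict_self ?mul0r.
by have := sub_restrict l c p; rewrite p0 subr0.
Qed.

(** The ideal of l is the kernel of a ring morphism to an integral domain. *)
Lemma linear_form_prime l p q : l != 0 ->
  divides (linear_form l) (p * q) ->
  divides (linear_form l) p \/ divides (linear_form l) q.
Proof.
move=> /pairing_exists[c lc] /(divides_restrict _ lc).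
rewrite rmorphM /= => /eqP; rewrite mulf_eq0.
by case/orP=> /eqP /(divides_restrict _ lc); [left | right].
Qed.

Lemma divides_linear_form l m : l != 0 ->
  divides (linear_form l) (linear_form m) -> m \in <[l]>%VS.
Proof.
move=> /pairing_exists[c lc] /(divides_restrict _ lc).
rewrite restrict_linear_form => /eqP; rewrite linear_form_eq0 subr_eq0.
by move=> /eqP ->; rewrite memvZ ?memv_line.
Qed.

Lemma is_arrangement_cons l A : is_arrangement (l :: A) =
  [&& l != 0, all (fun m => m \notin <[l]>%VS) A & is_arrangement A].
Proof. by rewrite /is_arrangement /= andbACA -!andbA. Qed.

Lemma mem_vline_sym l m : l != 0 -> l \in <[m]>%VS -> m \in <[l]>%VS.
Proof.
move=> l0 /vlineP[x lx]; apply/vlineP; exists x^-1.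
rewrite lx scalerA mulVf ?scale1r //.
by apply: contraNneq l0 => x0; rewrite lx x0 scale0r.
Qed.

Lemma defining_poly_cons l A :
  defining_poly (l :: A) = linear_form l * defining_poly A.
Proof. by rewrite /defining_poly big_cons. Qed.

Lemma defining_poly_neq0 A : is_arrangement A -> defining_poly A != 0.
Proof.
case/andP => /allP A0 _; rewrite prodf_seq_neq0; apply/allP => l lA.
by rewrite linear_form_eq0 A0.
Qed.

Lemma defining_poly_divides A h : is_arrangement A ->
  (forall l, l \in A -> divides (linear_form l) h) -> divides (defining_poly A) h.
Proof.
elim: A h => [|l A IH] h; first by exists h; rewrite /defining_poly big_nil mul1r.
rewrite is_arrangement_cons => /and3P[l0 /allP lA arrA] dvd_h.
have [q hq] := dvd_h l (mem_head _ _).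
case: (IH q arrA) => [m mA|s qs]; last first.
  by exists s; rewrite hq qs defining_poly_cons mulrA.
have m0 : m != 0 by case/andP: arrA => /allP /(_ _ mA).
have : divides (linear_form m) (linear_form l * q).
  by rewrite -hq; apply: dvd_h; rewrite inE mA orbT.
case/(linear_form_prime m0) => // /(divides_linear_form m0).
by move=> /(mem_vline_sym l0); rewrite (negbTE (lA _ mA)).
Qed.

(** A form of degree d cannot have more than d distinct linear factors.  This
replaces counting the zeros of a binary form. *)
Lemma homog_divisible_eq0 A d h : is_arrangement A -> h \is d.-homog ->
  (d < size A)%N -> (forall l, l \in A -> divides (linear_form l) h) -> h = 0.
Proof.
move=> arrA hh dA /(defining_poly_divides arrA)[q hq].
apply: contraTeq dA => h0; rewrite -leqNgt.
rewrite leqNgt; apply: contra h0 => dA; rewrite hq.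
move: hh; rewrite hq => /(homog_factor (defining_poly_neq0 arrA)).
by move=> /(_ _ (defining_poly_homog A))[_ ->] //; rewrite mulr0.
Qed.

Lemma uniq_arrangement A : is_arrangement A -> uniq A.
Proof.
elim: A => //= l A IH; rewrite is_arrangement_cons => /and3P[_ /allP lA /IH ->].
by rewrite andbT; apply/negP => /lA; rewrite memv_line.
Qed.

Lemma arrangement_neq0 A l : is_arrangement A -> l \in A -> l != 0.
Proof. by case/andP => /allP A0 _ /A0. Qed.

Lemma arrangement_nonprop A l m : is_arrangement A -> l \in A -> m \in A ->
  l != m -> m \notin <[l]>%VS.
Proof.
elim: A => //= k A IH; rewrite is_arrangement_cons.
move=> /and3P[k0 /allP kA arrA]; rewrite !inE.
case/predU1P=> [->|lA] /predU1P[->|mA]; rewrite ?eqxx //.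
- by move=> _; exact: kA.
- by move=> _; apply/negP => /(mem_vline_sym k0); apply/negP/kA.
- exact: IH.
Qed.

Lemma not_divides_defining_poly l A : l != 0 ->
  (forall m, m \in A -> m \notin <[l]>%VS) ->
  ~ divides (linear_form l) (defining_poly A).
Proof.
move=> l0; elim: A => [_|m A IH mA].
  have [c lc] := pairing_exists l0; rewrite /defining_poly big_nil.
  by move/(divides_restrict _ lc)/eqP; rewrite rmorph1 oner_eq0.
rewrite defining_poly_cons => /(linear_form_prime l0)[].
  by move/(divides_linear_form l0); apply/negP/mA/mem_head.
by apply: IH => k kA; apply: mA; rewrite inE kA orbT.
Qed.

(** With f = l g, the equation D(l) g + l D(g) = 0 shows that l divides D(l) g,
and l is prime and does not divide g. *)
Lemma syzygy_tangent A a l : is_arrangement A -> l \in A ->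
  derive a (defining_poly A) = 0 ->
  divides (linear_form l) (derive a (linear_form l)).
Proof.
move=> arrA lA; rewrite /defining_poly (perm_big _ (perm_to_rem lA)) /=.
rewrite big_cons -/(defining_poly (rem l A)) deriveM => /eqP.
rewrite addr_eq0 => /eqP al.
have l0 := arrangement_neq0 arrA lA.
have : divides (linear_form l)
         (derive a (linear_form l) * defining_poly (rem l A)).
  by rewrite al; exists (- derive a (defining_poly (rem l A))); rewrite mulrN.
case/(linear_form_prime l0) => // /not_divides_defining_poly[] // m.
rewrite mem_rem_uniq ?uniq_arrangement // inE => /andP[ml mA].
by apply: arrangement_nonprop arrA lA mA _; rewrite eq_sym.
Qed.

(** * The Euler correction and upper bounds for the minimal degree *)

Hypothesis charK : [pchar K] =i pred0.

Lemma natr_mpoly_eq0 n : (n%:R == 0 :> {mpoly K[3]}) = (n == 0)%N.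
Proof.
have -> : n%:R = (n%:R : K)%:MP :> {mpoly K[3]} by rewrite rmorph_nat.
by rewrite mpolyC_eq0; move/pcharf0P: charK => ->.
Qed.

Definition euler_correction n a q i : {mpoly K[3]} := n%:R * a i - q * 'X_i.

Lemma derive_euler_correction n a q p : derive (euler_correction n a q) p =
  n%:R * derive a p - q * derive (fun i => 'X_i) p.
Proof.
rewrite -mulNr -derive_comb; apply: eq_bigr => i _.
by rewrite mulNr.
Qed.

Lemma euler_correction_syzygy A a q :
  derive a (defining_poly A) = q * defining_poly A ->
  derive (euler_correction (size A) a q) (defining_poly A) = 0.
Proof. by move=> aA; rewrite derive_euler_correction aA euler; ring. Qed.

Lemma euler_correction_homog n a q d :
  (forall i, a i \is d.-homog) -> (forall i, q * 'X_i \is d.-homog) ->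
  forall i, euler_correction n a q i \is d.-homog.
Proof.
move=> ha hq i; rewrite rpredB // -[n%:R](rmorph_nat (@mpolyC 3 K)).
by rewrite mul_mpolyC; apply: dhomogZ.
Qed.

(** If n D = q E, then applying both sides to a form annihilated by D, on which E
acts by a nonzero scalar, gives q = 0 and then D = 0.  The form is the defining
polynomial of an arrangement B that may differ from the one for which D is being
corrected. *)
Lemma euler_correction_neq0 n B a q : (0 < n)%N -> is_arrangement B ->
  (0 < size B)%N -> derive a (defining_poly B) = 0 -> (exists i, a i != 0) ->
  exists i, euler_correction n a q i != 0.
Proof.
move=> n0 arrB B0 aB [i ai]; apply/existsP; apply: contraNT ai.
rewrite negb_exists => /forallP e0.
have {}e0 j : euler_correction n a q j = 0 by apply/eqP; have := e0 j; rewrite negbK.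
have : derive (euler_correction n a q) (defining_poly B) = 0.
  by rewrite /derive big1 // => j _; rewrite e0 mul0r.
rewrite derive_euler_correction aB euler mulr0 sub0r => /eqP.
rewrite oppr_eq0 !mulf_eq0 natr_mpoly_eq0 (negbTE (defining_poly_neq0 arrB)).
rewrite eqn0Ngt B0 !orbF => /eqP q0.
move: (e0 i); rewrite /euler_correction q0 mul0r subr0 => /eqP.
by rewrite mulf_eq0 natr_mpoly_eq0 eqn0Ngt n0.
Qed.

Lemma mdrP A : has_jacobian_syzygy (defining_poly A) (mdr A).
Proof. by rewrite /mdr; case: ex_minnP => r /asboolP. Qed.

Lemma mdr_le A r : has_jacobian_syzygy (defining_poly A) r -> (mdr A <= r)%N.
Proof.
move=> hr; rewrite /mdr; case: ex_minnP => s _; apply.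
exact/asboolP.
Qed.

Lemma derive_linear_form_homog a d l :
  (forall i, a i \is d.-homog) -> derive a (linear_form l) \is d.-homog.
Proof.
by move=> ha; rewrite derive_linear_form rpred_sum // => i _; exact: dhomogZ.
Qed.

(** If T annihilates f', then L T multiplies L f' by T(L), and the Euler correction
of L T annihilates L f'. *)
Lemma mdr_cons_le A L : is_arrangement A -> (0 < size A)%N -> L != 0 ->
  (mdr (L :: A) <= (mdr A).+1)%N.
Proof.
move=> arrA A0 L0; have [t [ht t0 tA]] := mdrP A; apply: mdr_le.
rewrite -/(derive t _) in tA; pose a i := linear_form L * t i.
have aE p : derive a p = linear_form L * derive t p.
  by rewrite /derive mulr_sumr; apply: eq_bigr => i _; rewrite mulrA.
have htL := derive_linear_form_homog L ht.
exists (euler_correction (size (L :: A)) a (derive t (linear_form L))); split.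
- apply: euler_correction_homog => i.
    by rewrite -[(mdr A).+1]add1n; apply: dhomogM (linear_form_homog L) (ht i).
  by rewrite -[(mdr A).+1]addn1; apply: dhomogM htL (variable_homog i).
- apply: (euler_correction_neq0 _ _ arrA A0) => //.
    by rewrite aE tA mulr0.
  by case: t0 => i ti; exists i; rewrite mulf_neq0 ?linear_form_eq0.
- apply: euler_correction_syzygy.
  by rewrite aE defining_poly_cons deriveM tA; ring.
Qed.

Lemma dim1_neq0 (P : {vspace 'rV[K]_3}) : \dim P = 1%N ->
  exists2 v, v \in P & v != 0.
Proof.
move=> dP; exists (vpick P); first exact: memv_pick.
by rewrite vpick0 -dimv_eq0 dP.
Qed.

(** Let v be a point on two lines l, m, and write the defining polynomial as
l m h.  The constant field v annihilates l and m, so h v multiplies l m h by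
v(h); its Euler correction has degree deg h, two less than the number of
lines. *)
Lemma mdr_add2_le_size A : is_arrangement A -> (2 <= size A)%N ->
  ((mdr A).+2 <= size A)%N.
Proof.
case: A => [|l [|m A]] // arrA _; rewrite ltnS ltnS; apply: mdr_le.
move: (arrA); rewrite is_arrangement_cons => /and3P[l0 /= /andP[ml _] _].
have [v] := dim1_neq0 (dim_capv_line l0 ml).
rewrite memv_cap !mem_line_pairing => /andP[/eqP lv /eqP mv] v0.
set h := defining_poly A.
have h0 : h != 0.
  by apply: defining_poly_neq0; move: arrA; rewrite !is_arrangement_cons => /and3P[_ _ /and3P[]].
pose e (i : 'I_3) : {mpoly K[3]} := (v 0 i)%:MP.
pose a i := h * e i.
have aE p : derive a p = h * derive e p.
  by rewrite /derive mulr_sumr; apply: eq_bigr => i _; rewrite mulrA.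
have eL k : pairing k v = 0 -> derive e (linear_form k) = 0.
  move=> kv; rewrite derive_linear_form -[RHS](mpolyC0 3 K) -kv raddf_sum /=.
  by apply: eq_bigr => i _; rewrite -mul_mpolyC mpolyCM.
exists (euler_correction (size [:: l, m & A]) a (derive e h)); split.
- apply: euler_correction_homog => i.
    by rewrite /a mulrC mul_mpolyC; apply/dhomogZ/defining_poly_homog.
  rewrite mulr_suml rpred_sum // => j _; rewrite mul_mpolyC -scalerAl.
  apply: dhomogZ; rewrite /h; case: (A) => [|k B].
    by rewrite /defining_poly big_nil -mpolyC1 mderivC mul0r dhomog0.
  have hd := mderiv_homog j (defining_poly_homog (k :: B)).
  by have := dhomogM hd (variable_homog i); rewrite addn1.
- apply: (@euler_correction_neq0 _ [:: l]) => //.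
  + by rewrite /is_arrangement /= l0.
  + by rewrite /defining_poly big_seq1 aE eL ?mulr0.
  + case/rV0Pn: v0 => i vi; exists i; rewrite mulf_neq0 // mpolyC_eq0 //.
- apply: euler_correction_syzygy.
  by rewrite aE !defining_poly_cons !deriveM !eL // -/h; ring.
Qed.

End Algebra.

(** * Adding a generic line raises the minimal degree by one *)

Section GenericLine.
Variable K : fieldType.
Implicit Types (l m k c : 'rV[K]_3) (P : {vspace 'rV[K]_3}).
Implicit Types (p q h : {mpoly K[3]}) (a b : 'I_3 -> {mpoly K[3]}).
Variables (A : seq 'rV[K]_3) (L : 'rV[K]_3).
Hypotheses (arrA : is_arrangement A) (genL : is_generic_line A L).

Lemma generic_arrangement : is_arrangement (L :: A).
Proof.
have [L0 /allP LA _] := genL; rewrite is_arrangement_cons L0 arrA andbT /=.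
apply/allP => l lA; apply: contra (LA l lA).
exact: mem_vline_sym (arrangement_neq0 arrA lA).
Qed.

Lemma generic_mult1 P l m : \dim P = 1%N -> (P <= line L)%VS ->
  l \in A -> m \in A -> (P <= line l)%VS -> (P <= line m)%VS -> l = m.
Proof.
move=> dP PL lA mA Pl Pm; have [_ _ /(_ P dP PL)] := genL.
rewrite leqNgt; apply: contraNeq => lm; rewrite /mult -size_filter.
apply: (@uniq_leq_size _ [:: l; m]); first by rewrite /= inE lm.
by move=> k; rewrite !inE mem_filter => /orP[] /eqP ->; rewrite ?Pl ?Pm.
Qed.

Lemma dim_generic_point l : l \in A -> \dim (line l :&: line L)%VS = 1%N.
Proof.
move=> lA; have [_ /allP/(_ l lA) Ll _] := genL.
exact: dim_capv_line (arrangement_neq0 arrA lA) Ll.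
Qed.

(** A line m of the pencil spanned by l and L passes through the point where l
meets L, and l is the only line of the arrangement through that point. *)
Lemma generic_independent l m x y : l \in A -> m \in A ->
  m = x *: l + y *: L -> l = m.
Proof.
move=> lA mA mE.
apply: (generic_mult1 (dim_generic_point lA)) => //; rewrite ?capvSl ?capvSr //.
apply/subvP => v; rewrite memv_cap !mem_line_pairing => /andP[/eqP lv /eqP Lv].
by rewrite mE pairing_comb lv Lv !mulr0 addr0.
Qed.

(** Lines l, m of the arrangement and L are not concurrent, so they form a basis of
the linear forms. *)
Lemma generic_span l m k : l \in A -> m \in A -> l != m ->
  exists x y z, k = x *: l + y *: m + z *: L.
Proof.
move=> lA mA lm.
have fr : free [:: m; l; L].
  have [L0 /allP LA _] := genL.
  rewrite !free_cons span_cons !span_seq1 span_nil nil_free andbT memv0 L0 andbT.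
  apply/andP; split; last first.
    apply/negP => /(mem_vline_sym (arrangement_neq0 arrA lA)).
    exact/negP/LA.
  apply: contra lm => /memv_addP[_ /vlineP[x ->] [_ /vlineP[y ->] mE]].
  by apply/eqP; exact: generic_independent mE.
have : k \in <<[:: m; l; L]>>%VS.
  suff -> : <<[:: m; l; L]>>%VS = fullv by rewrite memvf.
  apply/eqP; rewrite eqEdim subvf /=; move: fr; rewrite /free => /eqP ->.
  by rewrite dimvf dim_matrix.
rewrite !span_cons span_nil addv0.
case/memv_addP=> [_ /vlineP[y ->] [w /memv_addP[_ /vlineP[x ->]]]].
move=> [_ /vlineP[z ->] ->] ->; exists x, y, z.
by rewrite addrA [y *: m + _]addrC.
Qed.

(** The restrictions to L of the lines of the arrangement are pairwise
non-proportional because these lines meet L in distinct points. *)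
Lemma restrict_arrangement c : pairing L c = 1 ->
  is_arrangement [seq l - pairing l c *: L | l <- A].
Proof.
move=> Lc; have [L0 /allP LA _] := genL; apply/andP; split.
  apply/allP => _ /mapP[l lA ->]; apply: contra (LA l lA).
  rewrite subr_eq0 => /eqP lE; apply: mem_vline_sym (arrangement_neq0 arrA lA) _.
  by rewrite lE memvZ ?memv_line.
have: {subset A <= A} by [].
move: {1 2 4}A (uniq_arrangement arrA); elim=> //= l B IH /andP[lB uB] BA.
rewrite IH // ?andbT; last by move=> k kB; rewrite BA // inE kB orbT.
apply/allP => _ /mapP[m mB ->]; apply: contra lB => /vlineP[x mE].
suff -> : l = m by [].
apply: (@generic_independent _ _ x (pairing m c - x * pairing l c)).
- exact: BA (mem_head _ _).
- by rewrite BA // inE mB orbT.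
- apply/(addIr (- (pairing m c *: L))); rewrite mE.
  by apply/rowP => i; rewrite !mxE; ring.
Qed.

Hypothesis charK : [pchar K] =i pred0.

(** In the notation of the proof, S k and T k are the restrictions to L of k and of
D(k).  As S L = T L = 0, the form g = T l S m - T m S l is, up to a scalar, the
determinant of D and of the Euler field along the plane L = 0.  Tangency of D to a
line k makes S k divide g, for all lines k of the arrangement, and there are
more of them than the degree r + 1 of g. *)
Lemma restricted_field_radial a c r : (forall i, a i \is r.-homog) ->
  derive a (defining_poly (L :: A)) = 0 -> pairing L c = 1 ->
  (2 <= size A)%N -> (r.+1 < size A)%N ->
  exists q, forall i, restrict L c (a i) = q * restrict L c 'X_i.
Proof.
move=> ha aLA Lc A2 rA.
pose S k := restrict L c (linear_form k).
pose T k := restrict L c (derive a (linear_form k)).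
have [l [m [lA mA lm]]] : exists l m, [/\ l \in A, m \in A & l != m].
  case: A A2 (uniq_arrangement arrA) => [|l [|m B]] // _ /= /andP[lm _].
  exists l, m; rewrite !inE !eqxx orbT; split=> //.
  by move: lm; rewrite inE negb_or => /andP[].
have TS k : k \in L :: A -> exists q, T k = S k * q.
  move=> kA; have [q kq] := syzygy_tangent generic_arrangement kA aLA.
  by exists (restrict L c q); rewrite /T kq rmorphM.
have SL : S L = 0 by exact: restrict_self.
have TL : T L = 0.
  by have [q ->] := TS L (mem_head _ _); rewrite SL mul0r.
have Scomb x y z : S (x *: l + y *: m + z *: L) = x *: S l + y *: S m.
  by rewrite /S !linearD !linearZ /= -/(S L) SL scaler0 addr0.
have Tcomb x y z : T (x *: l + y *: m + z *: L) = x *: T l + y *: T m.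
  have TE k : T k = \sum_i k 0 i *: restrict L c (a i).
    rewrite /T derive_linear_form raddf_sum.
    by apply: eq_bigr => i _; rewrite /= linearZ.
  have -> : T (x *: l + y *: m + z *: L) = x *: T l + y *: T m + z *: T L.
    rewrite !TE !scaler_sumr -!big_split /=; apply: eq_bigr => i _.
    by rewrite !mxE !scalerA !scalerDl.
  by rewrite TL scaler0 addr0.
pose g := T l * S m - T m * S l.
have g0 : g = 0.
  have hS k : S k \is 1.-homog by apply/restrict_homog/linear_form_homog.
  have hT k : T k \is r.-homog by apply/restrict_homog/derive_linear_form_homog.
  have hg : g \is r.+1.-homog.
    by rewrite -[r.+1]addn1 rpredB // dhomogM.
  apply: homog_divisible_eq0 (restrict_arrangement Lc) hg _ _.
    by rewrite size_map.
  move=> _ /mapP[k kA ->]; rewrite -restrict_linear_form -/(S k).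
  have [x [y [z kE]]] := generic_span k lA mA lm.
  have [q Tk] : exists q, T k = S k * q by apply: TS; rewrite inE kA orbT.
  have div_scal w : w != 0 -> (exists s, w *: g = S k * s) -> divides (S k) g.
    move=> w0 [s gs]; exists (w^-1 *: s); rewrite -scalerAr -gs scalerA.
    by rewrite mulVf ?scale1r.
  (* Writing k = x l + y m + z L, both x g and y g are combinations of T k and
     S k, and x and y do not both vanish since k is not proportional to L. *)
  have [x0|x0] := eqVneq x 0; last first.
    apply: (div_scal x) => //; exists (q * S m - T m).
    move: Tk; rewrite kE Scomb Tcomb => Tk.
    have -> : x *: g = (x *: T l + y *: T m) * S m - T m * (x *: S l + y *: S m).
      rewrite /g -!mul_mpolyC; ring.
    by rewrite Tk; ring.
  have [y0|y0] := eqVneq y 0; last first.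
    apply: (div_scal y) => //; exists (T l - q * S l).
    move: Tk; rewrite kE Scomb Tcomb => Tk.
    have -> : y *: g = T l * (x *: S l + y *: S m) - (x *: T l + y *: T m) * S l.
      rewrite /g -!mul_mpolyC; ring.
    by rewrite Tk; ring.
  have [_ /allP/(_ k kA)/negP[]] := genL.
  apply: mem_vline_sym (arrangement_neq0 arrA kA) _.
  by rewrite kE x0 y0 !scale0r !add0r memvZ ?memv_line.
have S0 k : k \in A -> S k != 0.
  move=> kA; rewrite /S restrict_linear_form linear_form_eq0.
  apply: (arrangement_neq0 (restrict_arrangement Lc)).
  exact: map_f.
have [q1 Tl] : exists q, T l = S l * q by apply: TS; rewrite inE lA orbT.
have [q2 Tm] : exists q, T m = S m * q by apply: TS; rewrite inE mA orbT.
have q12 : q1 = q2.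
  move/eqP: g0; rewrite /g Tl Tm.
  have -> : S l * q1 * S m - S m * q2 * S l = (S l * S m) * (q1 - q2) by ring.
  by rewrite !mulf_eq0 !(negbTE (S0 _ _)) //= subr_eq0 => /eqP.
(* The identity T k = q1 S k holds for l, m and L, hence for all linear forms
   k, in particular for the coordinates. *)
exists q1 => i.
have [x [y [z eE]]] := generic_span (delta_mx 0 i) lA mA lm.
have XE b j : \sum_k (delta_mx 0 j : 'rV[K]_3) 0 k *: b k = b j :> {mpoly K[3]}.
  rewrite (bigD1 j) //= big1 => [|k kj]; rewrite !mxE eqxx /=.
    by rewrite eqxx scale1r addr0.
  by rewrite (negbTE kj) scale0r.
have -> : restrict L c (a i) = T (delta_mx 0 i).
  by rewrite /T derive_linear_form XE.
have -> : restrict L c 'X_i = S (delta_mx 0 i).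
  by rewrite /S /linear_form XE.
rewrite eE Scomb Tcomb Tl Tm q12 -!mul_mpolyC; ring.
Qed.

(** The field b is the correction of a that annihilates the defining polynomial of
A.  On L it is a multiple q' E of the Euler field, so q' is zero because E acts on
that polynomial by a nonzero scalar and L does not divide it.  Hence b is divisible
by L, and the quotient is the required syzygy. *)
Lemma syzygy_divided_by_generic_line r :
  has_jacobian_syzygy (defining_poly (L :: A)) r ->
  (2 <= size A)%N -> (r.+1 < size A)%N ->
  (0 < r)%N /\ has_jacobian_syzygy (defining_poly A) r.-1.
Proof.
move=> [a [ha a0 aLA]] A2 rA; rewrite -/(derive a _) in aLA.
have [L0 /allP LA _] := genL.
have A0 : (0 < size A)%N by apply: leq_trans A2.
have fL0 : linear_form L != 0 by rewrite linear_form_eq0.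
have [c Lc] := pairing_exists L0.
have [q aq] := restricted_field_radial ha aLA Lc A2 rA.
have [g Lg] := syzygy_tangent generic_arrangement (mem_head _ _) aLA.
have aA : derive a (defining_poly A) = (- g) * defining_poly A.
  move: aLA; rewrite defining_poly_cons deriveM Lg => /eqP.
  rewrite -mulrA -mulrDr mulf_eq0 (negbTE fL0) /= addrC addr_eq0 => /eqP ->.
  by rewrite mulNr.
pose b := euler_correction (size A) a (- g).
have bA : derive b (defining_poly A) = 0 by exact: euler_correction_syzygy.
have b0 : exists i, b i != 0.
  by apply: (euler_correction_neq0 charK _ A0 generic_arrangement).
have hb i : b i \is r.-homog.
  apply: euler_correction_homog => // {}i; rewrite mulNr rpredN.
  have := derive_linear_form_homog L ha; rewrite Lg.
  case/(homog_factor fL0 (linear_form_homog L)).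
  case: (r) => [_ -> //|s hg _]; first by rewrite mul0r dhomog0.
  by have := dhomogM hg (variable_homog K i); rewrite subn1 addn1.
pose q' := (size A)%:R * q + restrict L c g.
have bq i : restrict L c (b i) = q' * restrict L c 'X_i.
  rewrite /b /euler_correction rmorphB !rmorphM rmorphN /= aq rmorph_nat.
  by rewrite /q'; ring.
have q'0 : q' = 0.
  have := congr1 (restrict L c) bA; rewrite rmorph0 /derive rmorph_sum /=.
  rewrite (eq_bigr (fun i => q' * restrict L c ('X_i * (defining_poly A)^`M(i)))).
    rewrite -mulr_sumr -rmorph_sum /= -/(derive (fun i => 'X_i) _) euler.
    rewrite rmorphM rmorph_nat => /eqP; rewrite !mulf_eq0 natr_mpoly_eq0 //.
    rewrite eqn0Ngt A0 /= => /orP[/eqP -> //|/eqP].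
    move/(divides_restrict _ Lc) => /not_divides_defining_poly[] // m mA.
    apply/negP => /(mem_vline_sym (arrangement_neq0 arrA mA)); exact/negP/LA.
  by move=> i _; rewrite rmorphM /= bq rmorphM /= mulrA.
have /fin_all_exists[t bt] i : exists t, b i = linear_form L * t.
  by apply/(divides_restrict _ Lc); rewrite bq q'0 mul0r.
have ht i : t i \is (r - 1).-homog /\ ((r < 1)%N -> t i = 0).
  by apply: (homog_factor fL0 (linear_form_homog L)); rewrite -bt.
have [i bi] := b0.
have ti : t i != 0 by apply: contra bi => /eqP ti; rewrite bt ti mulr0.
have r0 : (0 < r)%N.
  by rewrite lt0n; apply: contra ti => /eqP r0; rewrite (ht i).2 // r0.
split=> //; exists t; split; last 1 first.
- apply: (mulfI fL0); rewrite mulr0 -[RHS]bA mulr_sumr.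
  by apply: eq_bigr => j _; rewrite bt mulrA.
- by move=> j; rewrite -subn1; case: (ht j).
- by exists i.
Qed.

(** If r + 1 < #A fails, the inequality r' + 1 <= r follows from r' + 2 <= #A. *)
Lemma mdr_generic : (2 <= size A)%N -> mdr (L :: A) = (mdr A + 1)%N.
Proof.
move=> A2; have [L0 _ _] := genL; apply/eqP; rewrite addn1 eqn_leq.
rewrite (mdr_cons_le charK arrA (ltnW A2) L0) /=.
have [small|big] := ltnP (mdr (L :: A)).+1 (size A).
  have [r0 hr] := syzygy_divided_by_generic_line (mdrP _) A2 small.
  by rewrite -(prednK r0) ltnS; exact: mdr_le.
have := mdr_add2_le_size charK arrA A2; move=> /leq_trans/(_ big).
by rewrite ltnS.
Qed.

End GenericLine.

(** * Multiple points of an arrangement with a generic line *)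

Section WeakCombinatorics.
Local Open Scope nat_scope.
Variable K : fieldType.
Implicit Types (A : seq 'rV[K]_3) (L l m : 'rV[K]_3) (P : {vspace 'rV[K]_3}).

Lemma mult_cons A L P : mult (L :: A) P = ((P <= line L)%VS + mult A P)%N.
Proof. by []. Qed.

Lemma multiple_points_generic A L : is_arrangement A -> is_generic_line A L ->
  perm_eq (multiple_points (L :: A))
    (multiple_points A ++ [seq (line l :&: line L)%VS | l <- A]).
Proof.
move=> arrA genL; have [L0 LA mult1] := genL.
have arrLA := generic_arrangement arrA genL.
have dimP := dim_generic_point arrA genL.
have offL P : P \in multiple_points A -> ~~ (P <= line L)%VS.
  rewrite mem_multiple_points // => /andP[/eqP dP].
  by rewrite ltnNge; apply: contra; exact: mult1.
apply: uniq_perm; first exact: undup_uniq.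
  rewrite cat_uniq undup_uniq map_inj_in_uniq ?uniq_arrangement //=.
    rewrite andbT; apply/hasPn => _ /mapP[l lA ->]; apply/negP => /offL.
    by rewrite capvSr.
  move=> l m lA mA lm.
  apply: (generic_mult1 genL (dimP l lA)) => //; rewrite ?capvSl ?capvSr //.
  by rewrite lm capvSl.
move=> P; rewrite mem_cat !mem_multiple_points // mult_cons.
apply/andP/orP => [[dP]|[/andP[dP m2]|/mapP[l lA ->]]].
- have [PL|PL] := boolP (P <= line L)%VS; last by left; rewrite dP.
  rewrite add1n ltnS -has_count => /hasP[l lA Pl]; right; apply/mapP; exists l => //.
  by apply/eqP; rewrite eqEdim subv_cap Pl PL dimP // (eqP dP).
- by rewrite dP (leq_trans m2) ?leq_addl.
- rewrite dimP // eqxx capvSr add1n ltnS -has_count; split=> //.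
  by apply/hasP; exists l => //; rewrite capvSl.
Qed.

Lemma n_points_generic A L j : is_arrangement A -> is_generic_line A L ->
  n_points (L :: A) j = (n_points A j + (j == 2) * size A)%N.
Proof.
move=> arrA genL; have [L0 LA mult1] := genL.
have dimP := dim_generic_point arrA genL.
rewrite /n_points (permP (multiple_points_generic arrA genL)) count_cat.
congr (_ + _)%N.
  apply: eq_in_count => P; rewrite mem_multiple_points // => /andP[/eqP dP m2].
  rewrite mult_cons; case: (boolP (P <= line L)%VS) => // /(mult1 P dP).
  by rewrite leqNgt m2.
rewrite count_map (eq_in_count (a2 := fun=> j == 2)).
  by case: eqP => _; rewrite ?count_predT ?count_pred0 ?mul1n ?mul0n.
move=> l lA; rewrite -[LHS]/(mult (L :: A) (line l :&: line L)%VS == j).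
rewrite mult_cons capvSr eq_sym; congr (_ == _).
apply/eqP; rewrite add1n eqSS eqn_leq mult1 ?dimP ?capvSr //= -has_count.
by apply/hasP; exists l => //; rewrite capvSl.
Qed.

Lemma n_points_gt_size A j : (size A < j)%N -> n_points A j = 0%N.
Proof.
move=> Aj; rewrite /n_points (eq_count (a2 := pred0)) ?count_pred0 // => P /=.
by apply/negbTE; rewrite neq_ltn (leq_ltn_trans (count_size _ _)).
Qed.

Lemma global_tjurina_generic A L : is_arrangement A -> is_generic_line A L ->
  (0 < size A)%N ->
  global_tjurina (L :: A) = (global_tjurina A + size A)%N.
Proof.
move=> arrA genL A0; rewrite /global_tjurina.
rewrite (eq_bigr (fun j => (n_points A j * (j - 1) ^ 2
                           + (j == 2) * size A)%N)); last first.
  move=> j _; rewrite n_points_generic // mulnDl; congr (_ + _)%N.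
  by have [->|] := eqVneq j 2; rewrite ?muln1.
rewrite big_split /=; congr (_ + _)%N.
  by rewrite big_nat_recr //= n_points_gt_size // mul0n addn0.
rewrite big_ltn // mul1n big_nat big1 ?addn0 // => j /andP[j2 _].
by rewrite gtn_eqF.
Qed.

Lemma sum_multiple_points A (F : nat -> nat) N : is_arrangement A ->
  (size A < N)%N ->
  \sum_(P <- multiple_points A) F (mult A P) =
  \sum_(2 <= j < N) n_points A j * F j.
Proof.
move=> arrA AN.
under [RHS]eq_bigr do rewrite /n_points -sum1_count big_mkcond big_distrl /=.
rewrite exchange_big /=; apply: eq_big_seq => P; rewrite mem_multiple_points //.
move=> /andP[_ m2]; have mN : (mult A P < N)%N.
  exact: leq_ltn_trans (count_size _ _) AN.
rewrite (bigD1_seq (mult A P)) ?mem_index_iota ?m2 ?mN ?iota_uniq //=.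
rewrite eqxx mul1n big1 ?addn0 // => j; rewrite eq_sym => /negbTE ->.
by rewrite mul0n.
Qed.

Lemma sum_distinct_pairs (T : eqType) (s : seq T) : uniq s ->
  \sum_(x <- s) \sum_(y <- s) (y != x) = (size s * (size s - 1))%N.
Proof.
move=> us; rewrite (eq_big_seq (fun=> size s - 1)%N) => [|x xs].
  by rewrite big_const_seq count_predT iter_addn_0 mulnC.
rewrite -(count_predC (pred1 x)) count_uniq_mem // xs addKn -sum1_count.
by rewrite [RHS]big_mkcond.
Qed.

Lemma capv_line_multiple_point A l m : is_arrangement A ->
  l \in A -> m \in A -> m != l ->
  (line l :&: line m)%VS \in multiple_points A /\
  \dim (line l :&: line m)%VS = 1%N.
Proof.
move=> arrA lA mA; rewrite eq_sym => lm.
have dP : \dim (line l :&: line m)%VS = 1%N.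
  exact: dim_capv_line (arrangement_neq0 arrA lA)
                       (arrangement_nonprop arrA lA mA lm).
split=> //; rewrite mem_undup mem_filter dP eqxx /=.
by apply/allpairsP; exists (l, m).
Qed.

(** Both sides count the ordered pairs of distinct lines, the left one according to
their intersection point. *)
Lemma sum_mult_pairs A : is_arrangement A ->
  \sum_(P <- multiple_points A) mult A P * (mult A P - 1) =
  (size A * (size A - 1))%N.
Proof.
move=> arrA; have uA := uniq_arrangement arrA.
transitivity (\sum_(P <- multiple_points A) \sum_(l <- A) \sum_(m <- A)
                ((m != l) && (P == (line l :&: line m)%VS)) : nat)%N.
  apply: eq_big_seq => P; rewrite mem_multiple_points // => /andP[/eqP dP _].
  rewrite /mult -!size_filter -sum_distinct_pairs ?filter_uniq //.
  rewrite big_filter big_mkcond; apply: eq_big_seq => l lA.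
  case: (boolP (P <= line l)%VS) => Pl; last first.
    rewrite big1 // => m _; have [PE|_] := eqVneq P (line l :&: line m)%VS; last by rewrite andbF.
    by rewrite PE capvSl in Pl.
  rewrite big_filter big_mkcond; apply: eq_big_seq => m mA.
  case: (eqVneq m l) => [|ml] /=; first by case: ifP.
  have [_ dlm] := capv_line_multiple_point arrA lA mA ml.
  by rewrite eqEdim subv_cap Pl dP dlm andbT; case: ifP.
rewrite exchange_big -(sum_distinct_pairs uA) /=.
apply: eq_big_seq => l lA; rewrite exchange_big /=; apply: eq_big_seq => m mA.
case: (eqVneq m l) => [|ml] /=; first by rewrite big1.
have [lmA _] := capv_line_multiple_point arrA lA mA ml.
under eq_bigr => P _ do rewrite -[nat_of_bool _]/(if P == _ then 1 else 0)%N.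
by rewrite -big_mkcond sum1_count count_uniq_mem ?undup_uniq // lmA.
Qed.

Lemma size_weak_combinatorics A B : is_arrangement A -> is_arrangement B ->
  (2 <= size A)%N -> (2 <= size B)%N ->
  same_weak_combinatorics A B -> size A = size B.
Proof.
move=> arrA arrB A2 B2 AB; pose N := (maxn (size A) (size B)).+1.
have : (size A * (size A - 1) = size B * (size B - 1))%N.
  pose F j := (j * (j - 1))%N.
  rewrite -sum_mult_pairs // -[RHS]sum_mult_pairs //.
  rewrite (@sum_multiple_points A F N) ?ltnS ?leq_maxl //.
  rewrite (@sum_multiple_points B F N) ?ltnS ?leq_maxr //.
  by rewrite !big_nat; apply: eq_bigr => j /andP[j2 _]; rewrite AB.
nia.
Qed.

Lemma same_weak_combinatorics_generic A B L M :
  is_arrangement A -> is_arrangement B -> (2 <= size A)%N -> (2 <= size B)%N ->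
  is_generic_line A L -> is_generic_line B M ->
  same_weak_combinatorics A B -> same_weak_combinatorics (L :: A) (M :: B).
Proof.
move=> arrA arrB A2 B2 genL genM AB j j2; rewrite !n_points_generic // AB //.
by rewrite (size_weak_combinatorics arrA arrB).
Qed.

End WeakCombinatorics.

(** * The intersection lattice of an arrangement with a generic line *)

Section Combinatorics.
Variable K : fieldType.
Implicit Types (A B : seq 'rV[K]_3) (L M l m : 'rV[K]_3).
Implicit Types (P X Y Z W : {vspace 'rV[K]_3}).

Lemma flat_fullv A : is_flat A fullv.
Proof. by exists [::] => //; rewrite big_nil. Qed.

Lemma flat_cap_line A X l : l \in A -> is_flat A X -> is_flat A (line l :&: X).
Proof.
move=> lA [C CA ->]; exists (l :: C); last by rewrite big_cons.
by move=> m; rewrite inE => /predU1P[->|/CA].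
Qed.

Lemma flat_ind A (Q : {vspace 'rV[K]_3} -> Prop) :
  Q fullv -> (forall l X, l \in A -> is_flat A X -> Q X -> Q (line l :&: X)%VS) ->
  forall X, is_flat A X -> Q X.
Proof.
move=> Q0 QS _ [C + ->]; elim: C => [_|l C IH CA]; first by rewrite big_nil.
have CA' : {subset C <= A} by move=> m mC; rewrite CA // inE mC orbT.
rewrite big_cons; apply: QS (IH CA'); first exact: CA (mem_head _ _).
by exists C.
Qed.

(** A flat is the intersection of the lines of the arrangement that contain it. *)
Lemma sub_flat A X Y : is_flat A X ->
  (forall l, l \in A -> (X <= line l)%VS -> (Y <= line l)%VS) -> (Y <= X)%VS.
Proof.
move: X; apply: flat_ind => [|l X lA _ IH YX]; first by rewrite subvf.
rewrite subv_cap YX ?capvSl // IH // => m mA Xm.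
by apply: YX => //; apply: subv_trans (capvSr _ _) Xm.
Qed.

Lemma dim_cap_line X l : (\dim X <= (\dim (line l :&: X)).+1)%N.
Proof.
have := dimv_sum_cap (line l) X; have := dim_line_ge l.
have := dimvS (subvf (line l + X)%VS); rewrite dimvf dim_matrix mul1r; lia.
Qed.

(** Write the flat as an intersection of lines and remove lines one by one: the
first removal that changes the intersection raises the dimension by one. *)
Lemma flat_cover A X : is_flat A X -> X != fullv ->
  exists Y, [/\ is_flat A Y, (X <= Y)%VS, X != Y & (\dim Y <= (\dim X).+1)%N].
Proof.
move: X; apply: flat_ind => [|l X lA flX IH]; first by rewrite eqxx.
have [->|neX] := eqVneq (line l :&: X)%VS X; first exact: IH.
by exists X; split=> //; rewrite ?capvSr // dim_cap_line.
Qed.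

(** An isomorphism of intersection lattices is handled as a relation between flats,
which makes the notion symmetric and avoids defining a map outside the flats. *)
Definition flat_isomorphism A B (R : {vspace 'rV[K]_3} -> {vspace 'rV[K]_3} -> Prop) :=
  [/\ forall X W, R X W -> is_flat A X /\ is_flat B W,
      forall X, is_flat A X -> exists W, R X W,
      forall W, is_flat B W -> exists X, R X W
    & forall X Y W Z, R X W -> R Y Z -> (X <= Y)%VS = (W <= Z)%VS].

Lemma flat_isomorphism_sym A B R :
  flat_isomorphism A B R -> flat_isomorphism B A (fun W X => R X W).
Proof.
case=> RF RA RB Rle; split=> //; first by move=> X W /RF[].
by move=> X Y W Z RX RY; rewrite (Rle _ _ _ _ RX RY).
Qed.

Lemma same_combinatoricsP A B :
  same_combinatorics A B <-> exists R, flat_isomorphism A B R.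
Proof.
split=> [[phi [phiA phiB phile]]|[R [RF RA RB Rle]]].
  exists (fun X W => is_flat A X /\ phi X = W); split.
  - by move=> X W [flX <-]; split=> //; exact: phiA.
  - by move=> X flX; exists (phi X).
  - by move=> W /phiB[X flX <-]; exists X.
  - by move=> X Y W Z [flX <-] [flY <-]; rewrite phile.
have /choice[phi phiP] X : exists W, is_flat A X -> R X W.
  by have [/RA[W RW]|] := pselect (is_flat A X); [exists W | exists X].
exists phi; split=> [X /phiP/RF[]//|W /RB[X RX]|X Y /phiP RX /phiP RY].
- exists X; first by case: (RF _ _ RX).
  have /RF[/phiP RX' _] := RX.
  by apply/eqP; rewrite eqEsubv -!(Rle _ _ _ _ RX' RX) -(Rle _ _ _ _ RX RX') subvv.
- by rewrite (Rle _ _ _ _ RX RY).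
Qed.

(** Downward induction on the dimension of X: a flat Y covering X in dimension
dim X + 1 is sent to a flat strictly larger than W, so
dim W < dim Z <= dim Y <= dim X + 1, where Z is the image of Y. *)
Lemma flat_isomorphism_dim_le A B R X W :
  flat_isomorphism A B R -> R X W -> (\dim W <= \dim X)%N.
Proof.
move=> [RF RA RB Rle].
have [n] : {n | 3 - \dim X <= n}%N by exists (3 - \dim X)%N.
elim: n X W => [|n IH] X W dX RX; have [flX flW] := RF _ _ RX.
  apply: leq_trans (_ : 3 <= _)%N; last by move: dX; rewrite leqn0 subn_eq0.
  by apply: leq_trans (dimvS (subvf _)) _; rewrite dimvf dim_matrix.
have [XV|/(flat_cover flX)[Y [flY XY neXY dY]]] := eqVneq X fullv.
  by rewrite XV; exact: dimvS (subvf _).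
have [Z RY] := RA Y flY.
have dXY : (\dim X < \dim Y)%N.
  rewrite ltn_neqAle dimvS // andbT; apply: contra neXY => /eqP dXY.
  by rewrite eqEdim XY dXY /=.
have ZW : ~~ (Z <= W)%VS.
  by rewrite -(Rle _ _ _ _ RY RX); apply: contra neXY => YX; rewrite eqEsubv XY.
have WZ : (W <= Z)%VS by rewrite -(Rle _ _ _ _ RX RY).
have dWZ : (\dim W < \dim Z)%N.
  by rewrite ltnNge; apply: contra ZW => dZ; have /eqP -> : W == Z by rewrite eqEdim WZ dZ.
have := IH Y Z _ RY; lia.
Qed.

Lemma flat_isomorphism_dim A B R X W :
  flat_isomorphism A B R -> R X W -> \dim W = \dim X.
Proof.
move=> isoR RX; apply/eqP; rewrite eqn_leq (flat_isomorphism_dim_le isoR RX).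
exact: (flat_isomorphism_dim_le (flat_isomorphism_sym isoR) RX).
Qed.

Section GenericFlats.
Variables (A : seq 'rV[K]_3) (L : 'rV[K]_3).
Hypotheses (arrA : is_arrangement A) (A0 : (0 < size A)%N).
Hypothesis genL : is_generic_line A L.

Lemma flat_in_line X : is_flat A X ->
  X = fullv \/ exists2 l, l \in A & (X <= line l)%VS.
Proof.
move=> flX; have [/hasP|/hasPn noline] := boolP (has (fun l => (X <= line l)%VS) A).
  by right.
left; apply/eqP; rewrite eqEsubv subvf /=; apply: (sub_flat flX) => l lA.
by rewrite (negbTE (noline l lA)).
Qed.

Lemma not_sub_generic_line l : l \in A ->
  ~~ (line l <= line L)%VS /\ ~~ (line L <= line l)%VS.
Proof.
move=> lA; have dlL := dim_generic_point arrA genL lA.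
have dl := dim_line_ge l; have dL := dim_line_ge L.
split; apply/negP.
  by move/capv_idPl => e; rewrite -e dlL in dl.
by move/capv_idPr => e; rewrite -e dlL in dL.
Qed.

(** A point of L lies on at most one line of the arrangement, whereas a flat of
dimension one lies on at least two. *)
Lemma flat_sub_generic_line X : is_flat A X ->
  (X <= line L)%VS = (\dim X == 0%N).
Proof.
move=> flX; apply/idP/idP => [XL|]; last by rewrite dimv_eq0 => /eqP ->; exact: sub0v.
have [XV|[l lA Xl]] := flat_in_line flX.
  have lA := mem_nth 0 A0; have [/negP[]] := not_sub_generic_line lA.
  by apply: subv_trans XL; rewrite XV subvf.
apply: contraT => X0; have dlL := dim_generic_point arrA genL lA.
have dX : \dim X = 1%N.
  have : (X <= line l :&: line L)%VS by rewrite subv_cap Xl.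
  move/dimvS; rewrite dlL; lia.
have lX : (line l <= X)%VS.
  apply: (sub_flat flX) => m mA Xm.
  by rewrite (generic_mult1 genL dX XL lA mA Xl Xm).
have := dim_line_ge l; have := dimvS lX; lia.
Qed.

(** If dim X <= 1, the trace of X on L is zero.  Otherwise X is the whole space or
a line l; in the second case the trace is a point through which l is the only
line of the arrangement, so every line containing the trace contains l. *)
Lemma flat_cap_generic_sub X Y : is_flat A X -> is_flat A Y ->
  (X :&: line L <= Y)%VS = (X <= Y)%VS || (\dim X <= 1)%N.
Proof.
move=> flX flY; apply/idP/orP => [XLY|[XY|dX]]; last 2 first.
- exact: subv_trans (capvSl _ _) XY.
- suff /eqP : \dim (X :&: line L)%VS == 0%N.
    by move/eqP; rewrite dimv_eq0 => /eqP ->; exact: sub0v.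
  apply: contraT => d0.
  have XL : (X <= line L)%VS.
    apply/capv_idPl/eqP; rewrite eqEdim capvSl /=; lia.
  have : (\dim (X :&: line L)%VS <= \dim X)%N by apply/dimvS/capvSl.
  by move: XL; rewrite flat_sub_generic_line // => /eqP ->; rewrite leqn0 (negbTE d0).
have [dX|dX] := leqP (\dim X) 1; [by right | left].
apply: (sub_flat flY) => m mA Ym; have XLm := subv_trans XLY Ym.
have [XV|[l lA Xl]] := flat_in_line flX.
  have [_ /negP[]] := not_sub_generic_line mA.
  by apply: subv_trans XLm; rewrite XV capvC capvf.
suff <- : l = m by [].
have dlL := dim_generic_point arrA genL lA.
have dXL : \dim (X :&: line L)%VS = 1%N.
  have := dim_cap_line X L; rewrite capvC.
  have /dimvS : (X :&: line L <= line l :&: line L)%VS.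
    by rewrite subv_cap capvSr andbT; exact: subv_trans (capvSl _ _) Xl.
  rewrite dlL; lia.
apply: (generic_mult1 genL dXL) => //; first exact: capvSr.
exact: subv_trans (capvSl _ _) Xl.
Qed.

End GenericFlats.

Definition trace (b : bool) L X := if b then (X :&: line L)%VS else X.

(** The right-hand side involves X and Y only through their inclusion and the
dimension of X, which an isomorphism of lattices preserves. *)
Lemma trace_le A L b b' X Y : is_arrangement A -> (0 < size A)%N ->
  is_generic_line A L -> is_flat A X -> is_flat A Y ->
  (trace b L X <= trace b' L Y)%VS =
  if b then (X <= Y)%VS || (\dim X <= 1)%N
  else (X <= Y)%VS && (b' ==> (\dim X == 0%N)).
Proof.
move=> arrA A0 genL flX flY; case: b b' => [] [] /=; rewrite ?andbT //.
- by rewrite subv_cap capvSr andbT (flat_cap_generic_sub arrA).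
- by rewrite (flat_cap_generic_sub arrA).
- by rewrite subv_cap (flat_sub_generic_line arrA).
Qed.

Lemma flat_trace A L b X : is_flat A X -> is_flat (L :: A) (trace b L X).
Proof.
move=> [C CA XE].
have flX : is_flat (L :: A) X by exists C => // l /CA lA; rewrite inE lA orbT.
by case: b => //=; rewrite capvC; apply: flat_cap_line flX; exact: mem_head.
Qed.

Lemma flat_cons A L Z : is_flat (L :: A) Z ->
  exists b X, is_flat A X /\ Z = trace b L X.
Proof.
move: Z; apply: flat_ind => [|l Z lA _ [b [X [flX ->]]]].
  by exists false, fullv; split=> //; exact: flat_fullv.
move: lA; rewrite inE => /predU1P[->|lA].
  exists true, X; split=> //; case: b => //=; last exact: capvC.
  by rewrite capvC -capvA capvv.
exists b, (line l :&: X)%VS; split; first exact: flat_cap_line.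
by case: b => //=; rewrite capvA.
Qed.

Lemma same_combinatorics_generic A B L M :
  is_arrangement A -> is_arrangement B -> (0 < size A)%N -> (0 < size B)%N ->
  is_generic_line A L -> is_generic_line B M ->
  same_combinatorics A B -> same_combinatorics (L :: A) (M :: B).
Proof.
move=> arrA arrB A0 B0 genL genM /same_combinatoricsP[R isoR].
apply/same_combinatoricsP; have dR := flat_isomorphism_dim isoR.
have [RF RA RB Rle] := isoR.
(* Flats and traces correspond through the same pair of flats; an element with
   several presentations is matched consistently since the order is preserved. *)
exists (fun Z Z' => exists b X W, [/\ R X W, Z = trace b L X & Z' = trace b M W]).
split.
- move=> _ _ [b [X [W [/RF[flX flW] -> ->]]]].
  by split; exact: flat_trace.
- move=> _ /flat_cons[b [X [/RA[W RX] ->]]].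
  by exists (trace b M W), b, X, W.
- move=> _ /flat_cons[b [W [/RB[X RX] ->]]].
  by exists (trace b L X), b, X, W.
- move=> _ _ _ _ [b [X [W [RX -> ->]]]] [b' [Y [Z [RY -> ->]]]].
  have [[flX flW] [flY flZ]] := (RF _ _ RX, RF _ _ RY).
  rewrite (trace_le _ _ arrA A0 genL flX flY) (trace_le _ _ arrB B0 genM flW flZ).
  by rewrite (dR _ _ RX) (Rle _ _ _ _ RX RY).
Qed.

End Combinatorics.

Theorem proposition4p15 (K : fieldType) (charK : [pchar K] =i pred0)
    (A' : seq 'rV[K]_3) (L : 'rV[K]_3)
    (arrA' : is_arrangement A') (d'_ge2 : (2 <= size A')%N)
    (genL : is_generic_line A' L) :
  [/\ forall (B' : seq 'rV[K]_3) (M : 'rV[K]_3),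
        is_arrangement B' -> (2 <= size B')%N -> is_generic_line B' M ->
        same_weak_combinatorics A' B' ->
        same_weak_combinatorics (L :: A') (M :: B'),
      forall (B' : seq 'rV[K]_3) (M : 'rV[K]_3),
        is_arrangement B' -> (2 <= size B')%N -> is_generic_line B' M ->
        same_combinatorics A' B' ->
        same_combinatorics (L :: A') (M :: B'),
      global_tjurina (L :: A') = (global_tjurina A' + size A')%N
    & mdr (L :: A') = (mdr A' + 1)%N].
Proof.
have nonempty (B : seq 'rV[K]_3) : (2 <= size B)%N -> (0 < size B)%N by exact: ltnW.
split=> [B' M arrB B2 genM|B' M arrB B2 genM||].
- exact: same_weak_combinatorics_generic.
- by apply: same_combinatorics_generic => //; exact: nonempty.
- by apply: global_tjurina_generic => //; exact: nonempty.
- exact: mdr_generic.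
Qed.
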